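(* Let $\mathcal P$ be a finite poset with $|\mathcal P|$ elements. Then there exists a constant $c$ depending only on $\mathcal P$ with $c \le |\mathcal P|^2/4+1$ such that $\mathrm{sat}^*(n,\mathcal P)=O(n^c)$ as $n\to\infty$.
   Context: A poset $(\mathcal Q,\preceq)$ contains an induced copy of a poset $(\mathcal P,\preceq')$ if there is an injective map $f:\mathcal P\to\mathcal Q$ such that $(f(\mathcal P),\preceq)$ is isomorphic to $(\mathcal P,\preceq')$ via $f$. The hypercube $Q_n$ is the power set $2^{[n]}$ of $[n]=\{1,\dots,n\}$ ordered by inclusion; a family $\mathcal F\subseteq 2^{[n]}$ is viewed as an induced subposet of $Q_n$. A family $\mathcal F\subseteq 2^{[n]}$ is $\mathcal P$-saturated if $\mathcal F$ contains no induced copy of $\mathcal P$, but for every $S\subseteq[n]$ with $S\notin\mathcal F$, the family $\mathcal F\cup\{S\}$ contains an induced copy of $\mathcal P$. The induced saturation number $\mathrm{sat}^*(n,\mathcal P)$ is the minimum size of a $\mathcal P$-saturated family of subsets of $[n]$. *)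

(* Defs.v *)
From mathcomp Require Import all_boot all_order all_algebra.
From mathcomp Require Import all_classical all_reals all_analysis.

Set Implicit Arguments.
Unset Strict Implicit.
Unset Printing Implicit Defensive.

Import Order.TTheory GRing.Theory Num.Theory.
Import numFieldNormedType.Exports.

Definition contains_induced_copy (d : Order.disp_t) (P : finPOrderType d)
    (n : nat) (F : {set {set 'I_n}}) : bool :=
  [exists f : {ffun P -> {set 'I_n}},
    [&& injectiveb f,
        [forall x, f x \in F]
      & [forall x, forall y, (x <= y)%O == (f x \subset f y)]]].

Definition saturated (d : Order.disp_t) (P : finPOrderType d)
    (n : nat) (F : {set {set 'I_n}}) : bool :=
  ~~ contains_induced_copy P F &&
  [forall S : {set 'I_n}, (S \notin F) ==> contains_induced_copy P (S |: F)].

(* The default [set0] of [arg min] is returned only when no saturated family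
   exists, i.e. when P is empty (see [sat_numP]); then [sat_num] is 0. *)
Definition sat_num (d : Order.disp_t) (P : finPOrderType d) (n : nat) : nat :=
  #|[arg min_(F < (finset.set0 : {set {set 'I_n}}) | saturated P F) #|F|]|.

Lemma exists_saturated (d : Order.disp_t) (P : finPOrderType d) (n : nat) :
  0 < #|P| -> exists F : {set {set 'I_n}}, saturated P F.
Proof.
move=> /card_gt0P[p _].
have h0 : ~~ contains_induced_copy P (finset.set0 : {set {set 'I_n}}).
  apply/negP => /existsP[f /and3P[_ /forallP /(_ p)]].
  by rewrite finset.in_set0.
have [F /maxsetP[hF maxF] _] :=
  @maxset_exists _ [pred F : {set {set 'I_n}} | ~~ contains_induced_copy P F]
    _ h0.
exists F; apply/andP; split=> //; apply/forallP => S; apply/implyP => SF.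
apply: contraNT SF => hS.
by rewrite -(maxF (S |: F) hS (subsetU1 _ _)) setU11.
Qed.

Lemma sat_numP (d : Order.disp_t) (P : finPOrderType d) (n : nat) :
  0 < #|P| ->
  (exists2 F : {set {set 'I_n}}, saturated P F & #|F| = sat_num P n) /\
  (forall F : {set {set 'I_n}}, saturated P F -> sat_num P n <= #|F|).
Proof.
move=> /(exists_saturated n)[F0 hF0].
rewrite /sat_num /arg_min /extremum; case: pickP => [F | none] /=.
  case/andP=> hF /forallP minF; split; first by exists F.
  by move=> G hG; move: (minF G); rewrite hG.
case: (arg_minnP (fun F : {set {set 'I_n}} => #|F|) hF0) => F hF minF.
have := none F; rewrite /= hF /= => /negbT /negP[].
by apply/forallP => G; apply/implyP => /minF.
Qed.

(* Main.v *)
(* Let h be the least height such that P embeds in a cube by sets of size at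
   most h. A ground set of such an embedding that is minimal for inclusion has
   size w <= |P|^2/4 + 2: each of its points is the only one to separate some
   pair x, y with x not below y, so these pairs, read as edges x -> y, come with
   cuts crossed by no other edge. Contracting the directed 2- and 3-cycles and
   applying Mantel's theorem to what remains bounds their number.
   The family of all sets of size less than h contains no copy of P by the
   choice of h; extend it to a saturated family F. If F shattered a set W of
   size w, then embedding P in the subsets of W and replacing the sets of size
   h by members of F with the same trace on W would give a copy of P in F.
   Hence F has VC dimension less than w, and |F| <= (n+1)^(w-1) by the
   Sauer-Shelah lemma. *)
Require Import Defs.
From mathcomp Require Import all_boot all_order all_algebra.
From mathcomp Require Import all_classical all_reals all_analysis.
From mathcomp Require Import zify lra.

Set Implicit Arguments.
Unset Strict Implicit.
Unset Printing Implicit Defensive.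

Import Order.TTheory GRing.Theory Num.Theory.
Import numFieldNormedType.Exports.

Section Combinatorics.
(* The classical set lemmas have the same names as those on [{set T}]. *)
Import fintype boot.finset.

(** * Mantel's theorem on triangle-free graphs *)

Lemma mantel (V : finType) (A : {set V}) (E : {set {set V}}) :
  (forall e, e \in E -> e \subset A /\ #|e| = 2) ->
  (forall x y z, [set x; y] \in E -> [set y; z] \in E -> [set x; z] \in E ->
     False) ->
  4 * #|E| <= #|A| ^ 2.
Proof.
move: {2}#|A|.+1 (ltnSn #|A|) => m; elim: m A E => // m IH A E ltAm EA Etri.
have [->|[e0 e0E]] := set_0Vmem E; first by rewrite cards0.
have [sA0 /eqP/cards2P[x [y [xy e0xy]]]] := EA e0 e0E; subst e0.
have xA : x \in A by apply: (subsetP sA0); rewrite !inE eqxx.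
have yA : y \in A by apply: (subsetP sA0); rewrite !inE eqxx orbT.
(* Both ends of one edge are deleted. Each [z] in [B] is joined to at most one of [x], [y], so at
   most [1 + #|B|] edges are lost. *)
pose B := A :\: [set x; y].
have cardB : #|A| = #|B| + 2.
  by rewrite -(cardsID [set x; y] A) (setIidPr sA0) cards2 xy addnC.
pose E' := [set e in E | e \subset B].
(* [phi z] is the edge joining [z] to [x] or [y] if there is one. Otherwise it is a non-edge, which
   is harmless in an upper bound. *)
pose phi z := if [set x; z] \in E then [set x; z] else [set y; z].
have cardE' : 4 * #|E'| <= #|B| ^ 2.
  apply: IH; first by lia.
    by move=> e; rewrite inE => /andP[/EA[_ ->]].
  move=> a b c; rewrite !inE => /andP[h1 _] /andP[h2 _] /andP[h3 _].
  exact: Etri h1 h2 h3.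
have sub : E \subset E' :|: ([set x; y] |: phi @: B).
  apply/subsetP => e eE; have [sA /eqP e2] := EA e eE.
  have inB z : z \in e -> z != x -> z != y -> z \in B.
    by move=> ze zx zy; rewrite !inE (negbTE zx) (negbTE zy) (subsetP sA).
  have other u : u \in e -> exists2 z, z != u & e = [set u; z].
    case/cards2P: e2 => a [b [ab ->]]; rewrite !inE => /orP[]/eqP->.
      by exists b; rewrite // eq_sym.
    by exists a; rewrite // setUC.
  rewrite !in_setU !inE eE /=.
  have [xe|xe] := boolP (x \in e).
    have [z zx ez] := other x xe; have [zy|zy] := eqVneq z y.
      by rewrite ez zy eqxx orbT.
    apply/orP; right; apply/orP; right; apply/imsetP; exists z.
      by apply: inB => //; rewrite ez !inE eqxx orbT.
    by rewrite /phi -ez eE.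
  have [ye|ye] := boolP (y \in e).
    have [z zy ez] := other y ye.
    have zx : z != x by apply: contraNneq xe => <-; rewrite ez !inE eqxx orbT.
    apply/orP; right; apply/orP; right; apply/imsetP; exists z.
      by apply: inB => //; rewrite ez !inE eqxx orbT.
    rewrite /phi; case: ifP => // xzE.
    by case: (Etri x y z); rewrite // -ez.
  apply/orP; left; apply/subsetP => z ze; apply: inB => //.
    by apply: contraNneq xe => <-.
  by apply: contraNneq ye => <-.
have := subset_leq_card sub.
have := cardsU1 [set x; y] (phi @: B).
have := (leq_card_setU E' ([set x; y] |: phi @: B)).1.
have := leq_imset_card phi (mem B); rewrite cardB; move: cardE'.
rewrite -!mulnn; move: #|E| #|E'| #|_ |: _| #|_ :|: _| #|_ @: _| #|B|.
case: (_ \notin _) => /=; nia.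
Qed.

(** * Directed graphs whose edges have private cuts *)

Lemma eq_set2 (V : finType) (a b x y : V) :
  a != b -> [set a; b] = [set x; y] -> (a = x /\ b = y) \/ (a = y /\ b = x).
Proof.
move=> ab /setP eqS; move: (eqS a) (eqS b) ab; rewrite !inE !eqxx orbT /=.
move=> /esym/orP[]/eqP-> /esym/orP[]/eqP->; rewrite ?eqxx //; by [left|right].
Qed.

(* The bound [max (q^2/4) (2q - 2)] on the number of edges on [q] vertices
   survives undoing the contraction of [k + 1] vertices joined by [r <= 2k]
   edges. *)
Lemma cut_bound_add p q r k : 0 < q -> r <= 2 * k ->
  4 * p <= q ^ 2 \/ p + 2 <= 2 * q ->
  4 * (p + r) <= (q + k) ^ 2 \/ p + r + 2 <= 2 * (q + k).
Proof.
move=> q0 rk [h|h]; last by right; lia.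
(* For [4 <= q] the term [2qk] of the square absorbs [4r <= 8k]. For smaller [q] the first
   alternative already gives [p <= 2q - 2]. *)
have [q4|q4] := leqP 4 q; first by left; rewrite -!mulnn in h *; nia.
right; have q3 : q < 4 by [].
move: q0 q3 h {q4}; case: q => [|[|[|[|]]]] //= _ _; rewrite -mulnn; lia.
Qed.

(** No edge other than [k] leaves [U k], so a directed cycle avoiding [k] lies on one side of this
    cut and can be contracted. Without directed 2- and 3-cycles the graph is triangle-free: in a
    transitive triangle, the path of two edges would cross the cut of the third. *)
Lemma private_cuts_bound (I V : finType) (J : {set I}) (A : {set V})
    (s t : I -> V) (U : I -> {set V}) :
  (forall i, i \in J -> s i \in A /\ t i \in A) ->
  (forall i j, i \in J -> j \in J ->
     (s j \in U i) && (t j \notin U i) = (i == j)) ->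
  4 * #|J| <= #|A| ^ 2 \/ #|J| + 2 <= 2 * #|A|.
Proof.
move: {2}#|A|.+1 (ltnSn #|A|) => m.
elim: m J A s t => // m IH J A s t ltAm stA cut.
(* [Y] is merged into [x] and the edges in [K] are dropped. The other cuts do not separate [Y] from
   [x], so they stay private to their edges. *)
have contract (K : {set I}) (Y : {set V}) x :
    x \in A -> x \notin Y -> Y \subset A -> K \subset J -> #|K| <= 2 * #|Y| ->
    0 < #|Y| ->
    (forall k, k \in J :\: K -> {in Y, forall y, (y \in U k) = (x \in U k)}) ->
    4 * #|J| <= #|A| ^ 2 \/ #|J| + 2 <= 2 * #|A|.
  move=> xA xY sYA sKJ KY Y0 cutY; pose c v := if v \in Y then x else v.
  have cA v : v \in A -> c v \in A :\: Y.
    by rewrite /c => vA; case: ifP => vY; rewrite inE ?xY ?vY.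
  have cU k v : k \in J :\: K -> (c v \in U k) = (v \in U k).
    by move=> kJ; rewrite /c; case: ifP => // vY; rewrite (cutY k kJ v vY).
  rewrite -(cardsID K J) -(cardsID Y A) (setIidPr sKJ) (setIidPr sYA).
  rewrite ![_ + #|_ :\: _|]addnC; apply: cut_bound_add => //.
    by apply/card_gt0P; exists x; rewrite inE xY.
  apply: (IH _ _ (c \o s) (c \o t)).
  - by rewrite cardsD (setIidPr sYA); have := subset_leq_card sYA; lia.
  - by move=> i /setDP[/stA[? ?] _]; split; exact: cA.
  - move=> i j iJ jJ; rewrite /= !cU //.
    by apply: cut; [case/setDP: iJ|case/setDP: jJ].
have noloop i : i \in J -> s i != t i.
  move=> iJ; apply/eqP => st; have := cut i i iJ iJ.
  by rewrite st eqxx andbN.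
have mono i k : i \in J -> k \in J -> k != i -> s i \in U k -> t i \in U k.
  move=> iJ kJ ki si; have := cut k i kJ iJ.
  by rewrite si (negbTE ki) /= => /negbFE.
have [/existsP[i /existsP[j /and4P[iJ jJ /eqP ij /eqP ji]]]|no2] :=
    boolP [exists i, exists j, [&& i \in J, j \in J, t i == s j & t j == s i]].
  have nij : i != j by apply: contraNneq (noloop i iJ) => e; rewrite ij e.
  have [sA tA] := stA i iJ.
  apply: (contract [set i; j] [set t i] (s i)) => //.
  - by rewrite inE noloop.
  - by rewrite sub1set.
  - by rewrite subUset !sub1set iJ jJ.
  - by rewrite cards2 cards1 nij.
  - by rewrite cards1.
  - move=> k; rewrite !inE negb_or => /andP[/andP[ki kj] kJ] y /set1P->.
    by apply/idP/idP; [rewrite ij -ji; exact: mono|exact: mono].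
have no2P i j : i \in J -> j \in J -> t i = s j -> t j = s i -> False.
  move=> iJ jJ h1 h2; case/negP: no2; apply/existsP; exists i; apply/existsP.
  by exists j; rewrite iJ jJ h1 h2 !eqxx.
have [/existsP[i /existsP[j /existsP[k]]]|no3] :=
    boolP [exists i, exists j, exists k, [&& i \in J, j \in J, k \in J,
      t i == s j, t j == s k & t k == s i]].
  case/and5P => iJ jJ kJ /eqP ij /andP[/eqP jk /eqP ki].
  have nij : i != j by apply: contraNneq (noloop i iJ) => e; rewrite ij e.
  have njk : j != k by apply: contraNneq (noloop j jJ) => e; rewrite jk e.
  have nki : k != i by apply: contraNneq (noloop k kJ) => e; rewrite ki e.
  have [sA tA] := stA i iJ; have [_ tA'] := stA j jJ.
  have ntt : t i != t j by rewrite ij noloop.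
  have nst : s i != t j by rewrite jk -ki eq_sym noloop.
  apply: (contract [set i; j; k] [set t i; t j] (s i)) => //.
  - by rewrite !inE negb_or noloop // nst.
  - by rewrite subUset !sub1set tA tA'.
  - by rewrite !subUset !sub1set iJ jJ kJ.
  - rewrite setUC cardsU1 !cards2 ntt !inE negb_or nki (eq_sym k j) njk.
    by case: (i != j).
  - by rewrite cards2 ntt.
  - move=> l; rewrite !inE !negb_or => /andP[/andP[/andP[li lj] lk] lJ] y.
    have mi := mono i l iJ lJ li; have mj := mono j l jJ lJ lj.
    have mk := mono k l kJ lJ lk; rewrite -ij in mj; rewrite -jk ki in mk.
    by case/set2P => ->; apply/idP/idP => h; auto.
have no3P i j k : i \in J -> j \in J -> k \in J ->
    t i = s j -> t j = s k -> t k = s i -> False.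
  move=> iJ jJ kJ h1 h2 h3; case/negP: no3; apply/existsP; exists i.
  apply/existsP; exists j; apply/existsP; exists k.
  by rewrite iJ jJ kJ h1 h2 h3 !eqxx.
have notrans i j k : i \in J -> j \in J -> k \in J ->
    t i = s j -> s k = s i -> t k = t j -> False.
  move=> iJ jJ kJ ij ski tkj.
  have := cut k k kJ kJ; rewrite eqxx ski tkj => /andP[si tj].
  have [ki|ki] := eqVneq k i.
    by have := noloop j jJ; rewrite -tkj ki ij eqxx.
  have [kj|kj] := eqVneq k j.
    by have := noloop i iJ; rewrite ij -kj ski eqxx.
  case/negP: tj; apply: (mono j) => //; rewrite -ij; exact: mono.
left; pose E := (fun i => [set s i; t i]) @: J.
have <- : #|E| = #|J|.
  apply: card_in_imset => i j iJ jJ /(eq_set2 (noloop i iJ))[][e1 e2].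
    apply/eqP; rewrite -(cut i j iJ jJ) -e1 -e2.
    by have := cut i i iJ iJ; rewrite eqxx.
  by case: (no2P i j).
apply: mantel => [e /imsetP[i iJ ->]|x y z].
  by have [sA tA] := stA i iJ; rewrite cards2 noloop // subUset !sub1set sA tA.
move=> /imsetP[i iJ /esym/(eq_set2 (noloop i iJ)) ei].
move=> /imsetP[j jJ /esym/(eq_set2 (noloop j jJ)) ej].
move=> /imsetP[k kJ /esym/(eq_set2 (noloop k kJ)) ek].
case: ei => [][i1 i2]; case: ej => [][j1 j2]; case: ek => [][k1 k2].
- by apply: (notrans i j k); congruence.
- by apply: (no3P i j k); congruence.
- by apply: (notrans k j i); congruence.
- by apply: (notrans k i j); congruence.
- by apply: (notrans i k j); congruence.
- by apply: (notrans j k i); congruence.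
- by apply: (no3P i k j); congruence.
- by apply: (notrans j i k); congruence.
Qed.

(** * Shattering and the Sauer-Shelah bound *)

Definition shatters (V : finType) (F : {set {set V}}) (W : {set V}) :=
  [forall A : {set V}, (A \subset W) ==> [exists B in F, B :&: W == A]].

Lemma shattersP (V : finType) (F : {set {set V}}) (W : {set V}) :
  reflect (forall A : {set V}, A \subset W -> exists2 B, B \in F & B :&: W = A)
          (shatters F W).
Proof.
apply: (iffP forallP) => [sh A AW|sh A].
  have /implyP/(_ AW)/existsP[B /andP[BF /eqP BA]] := sh A.
  by exists B.
apply/implyP => /sh[B BF BA]; apply/existsP; exists B.
by rewrite BF BA eqxx.
Qed.

Lemma sub_shatters (V : finType) (F : {set {set V}}) (W W' : {set V}) :
  W' \subset W -> shatters F W -> shatters F W'.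
Proof.
move=> sW /shattersP sh; apply/shattersP => A AW'.
have [B BF BW] := sh A (subset_trans AW' sW); exists B => //.
by rewrite -(setIidPr sW) setIA BW (setIidPl AW').
Qed.

Lemma shatters_sub_family (V : finType) (F G : {set {set V}}) (W : {set V}) :
  F \subset G -> shatters F W -> shatters G W.
Proof.
move=> sFG /shattersP sh; apply/shattersP => A /sh[B BF BA].
by exists B => //; apply: (subsetP sFG).
Qed.

(* Pajor's strengthening of the Sauer-Shelah lemma. *)
Lemma card_le_shattered (V : finType) (F : {set {set V}}) :
  #|F| <= #|[set W | shatters F W]|.
Proof.
move: {2}#|F|.+1 (ltnSn #|F|) => m; elim: m F => // m IH F ltFm.
have [F1|] := leqP #|F| 1.
  have [->|[B BF]] := set_0Vmem F; first by rewrite cards0.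
  apply: leq_trans F1 _; apply/card_gt0P; exists set0; rewrite inE.
  by apply/shattersP => A; rewrite subset0 => /eqP->; exists B; rewrite ?setI0.
case/card_gt1P => B [C [BF CF BC]].
(* Splitting [F] at a point where two members differ makes both halves proper, as the induction
   requires. *)
have [x xBC] : exists x, (x \in B) != (x \in C).
  apply/existsP; apply: contraNT BC => /existsPn e.
  by apply/eqP/setP => x; move: (e x); rewrite negbK => /eqP.
pose G b := [set D in F | (x \in D) == b].
have GF b : G b \subset F by apply/subsetP => D; rewrite inE => /andP[].
have cardF : #|F| = #|G true| + #|G false|.
  rewrite -(cardsID [set D : {set V} | x \in D] F); congr (_ + _).
    by apply: eq_card => D; rewrite !inE eqb_id.
  by apply: eq_card => D; rewrite !inE eqbF_neg andbC.
have ltG b : #|G b| < #|F|.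
  apply: proper_card; rewrite properE GF; apply/subsetPn.
  have [e|e] := eqVneq (x \in B) b; [exists C|exists B]; rewrite // inE.
    by rewrite CF -e eq_sym xBC.
  by rewrite BF e.
pose S b := [set W | shatters (G b) W].
have IHG b : #|G b| <= #|S b| by apply: IH; exact: leq_trans (ltG b) _.
(* Members of [G b] agree at [x], so a trace with the opposite value at [x] is never attained. *)
have notx b W : W \in S b -> x \notin W.
  rewrite inE => /shattersP sh; apply/negP => xW.
  have sA : (if b then set0 else [set x]) \subset W.
    by case: (b); rewrite ?sub0set ?sub1set.
  have [D DG DW] := sh _ sA.
  move: DG; rewrite inE => /andP[_ /eqP xD].
  by move/setP/(_ x): DW; rewrite inE xD xW; case: (b); rewrite !inE ?eqxx.
(* A set shattered by both halves counts twice in the sum; adding [x] to it gives a second set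
   shattered by [F]. *)
pose Sx := (fun W => x |: W) @: (S true :&: S false).
have disj : [disjoint S true :|: S false & Sx].
  rewrite -setI_eq0; apply/eqP/setP => W; rewrite !in_setI in_setU in_set0.
  apply/negP => /andP[WS /imsetP[W' _ eW]].
  have : x \in W by rewrite eW setU11.
  by case/orP: WS => /notx/negbTE->.
have cardI : #|Sx| = #|S true :&: S false|.
  apply: card_in_imset => W W' /setIP[/notx xW _] /setIP[/notx xW' _] e.
  by rewrite -(setU1K xW) e setU1K.
apply: leq_trans (_ : #|(S true :|: S false) :|: Sx| <= _); last first.
  apply: subset_leq_card; apply/subsetP => W; rewrite in_setU => /orP[].
    by case/setUP; rewrite !inE; exact: shatters_sub_family.
  case/imsetP => W' /setIP[W1 W0] ->; rewrite inE; apply/shattersP => A AW.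
  have xW' := notx _ _ W1.
  have AW' : A :\ x \subset W' by rewrite subDset.
  have {W1 W0} : shatters (G (x \in A)) W'.
    by move: W1 W0; rewrite !inE; case: (x \in A).
  case/shattersP/(_ _ AW') => D; rewrite inE => /andP[DF /eqP xD] DW.
  exists D => //; apply/setP => y; move/setP/(_ y): DW; rewrite !inE.
  by have [->|] := eqVneq y x; rewrite ?xD ?andbT.
rewrite cardsU (disjoint_setI0 disj) cards0 subn0 cardI cardsUI cardF.
exact: leq_add.
Qed.

(** A set is coded by a list of its elements padded with [None] to length [k], that is, by a map
    from ['I_k] to [option V]. *)
Lemma card_small_sets (V : finType) k :
  #|[set W : {set V} | #|W| <= k]| <= #|V|.+1 ^ k.
Proof.
pose im (f : {ffun 'I_k -> option V}) := [set x | [exists i, f i == Some x]].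
rewrite -card_option -{2}[k]card_ord -card_ffun -cardsT.
apply: leq_trans (leq_imset_card im setT); apply: subset_leq_card.
apply/subsetP => W; rewrite inE => Wk; apply/imsetP.
exists [ffun i : 'I_k => nth None [seq Some x | x <- enum W] i] => //.
have sz : size [seq Some x | x <- enum W] = #|W| by rewrite size_map -cardE.
apply/setP => x; rewrite inE; apply/idP/existsP => [xW|[i]].
  have xs : Some x \in [seq Some x | x <- enum W].
    by apply: map_f; rewrite mem_enum.
  have lt : index (Some x) [seq Some x | x <- enum W] < k.
    by apply: leq_trans Wk; rewrite -sz index_mem.
  by exists (Ordinal lt); rewrite ffunE nth_index.
rewrite ffunE => /eqP e; have : Some x \in [seq Some x | x <- enum W].
  rewrite -e; apply: mem_nth; rewrite ltnNge; apply/negP => /(nth_default None).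
  by rewrite e.
by case/mapP => y; rewrite mem_enum => yW [->].
Qed.

(** Shattering passes to subsets, so all shattered sets have size less than [w], and Pajor's bound
    leaves only small sets to count. *)
Lemma card_no_shattered (V : finType) (F : {set {set V}}) w :
  (forall W : {set V}, #|W| = w -> ~~ shatters F W) ->
  #|F| <= #|V|.+1 ^ w.-1.
Proof.
move=> noW; apply: leq_trans (card_le_shattered F) _.
apply: leq_trans (card_small_sets V w.-1).
apply: subset_leq_card; apply/subsetP => W; rewrite !inE => shW.
case: (leqP w #|W|) => [/card_geqP[r [ur rw rW]]|]; last by case: (w).
have /noW/negP[] : #|[set x in r]| = w by rewrite cardsE (card_uniqP ur).
by apply: sub_shatters shW; apply/subsetP => x; rewrite inE => /rW.
Qed.

(** * Embeddings of [P] in cubes and saturated families *)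

Section Embeddings.
Context (d : Order.disp_t) (P : finPOrderType d).

Definition embeds (V : finType) (f : P -> {set V}) :=
  [forall x, forall y, (x <= y)%O == (f x \subset f y)].

Lemma embedsP (V : finType) (f : P -> {set V}) :
  reflect (forall x y, (x <= y)%O = (f x \subset f y)) (embeds f).
Proof.
apply: (iffP forallP) => [h x y|h x]; last by apply/forallP => y; rewrite h.
by have /forallP/(_ y)/eqP := h x.
Qed.

Lemma embeds_inj (V : finType) (f : P -> {set V}) : embeds f -> injective f.
Proof. by move=> /embedsP h x y e; apply/le_anti; rewrite !h e subxx. Qed.

Lemma embeds_small_ground (V : finType) (f : P -> {set V}) :
  0 < #|P| -> embeds f ->
  exists w (g : P -> {set 'I_w}),
    [/\ embeds g, forall x, #|g x| <= #|f x| & 4 * w <= #|P| ^ 2 + 8].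
Proof.
move=> P0 embf; pose sep (I : {set V}) := embeds (fun x => f x :&: I).
have sepT : sep setT.
  by apply/embedsP => x y; rewrite !setIT; move/embedsP: embf.
have [I minI] := ex_minset (ex_intro (fun I => sep I) _ sepT).
have sepI : sep I := minsetp minI.
exists #|I|, (fun x => enum_val @^-1: f x); split.
- apply/embedsP => x y; move/embedsP: sepI => ->.
  apply/subsetP/subsetP => [sxy k|sxy v /setIP[vx vI]].
    rewrite !inE => kx; have := sxy (enum_val k).
    by rewrite !inE enum_valP !andbT; apply.
  rewrite inE vI andbT; have := sxy (enum_rank_in vI v).
  by rewrite !inE enum_rankK_in //; apply.
- move=> x; rewrite -(card_imset _ enum_val_inj); apply: subset_leq_card.
  by apply/subsetP => _ /imsetP[k + ->]; rewrite inE.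
(* By minimality, removing [i] from [I] breaks the embedding: some pair is separated within [I] by
   [i] alone. The pair [(x0, x0)] is a dummy for [i] outside [I]. *)
have priv i : exists p : P * P, i \in I ->
    ~~ (p.1 <= p.2)%O && (f p.1 :&: (I :\ i) \subset f p.2 :&: (I :\ i)).
  have /card_gt0P[x0 _] := P0.
  have [iI|iI] := boolP (i \in I); last by exists (x0, x0).
  have /forallPn[x /forallPn[y xy]] : ~~ sep (I :\ i).
    apply/negP => sepi; have := minsetinf minI sepi (subD1set _ _).
    by move/setP/(_ i); rewrite !inE eqxx iI.
  exists (x, y) => _ /=; have [le|nle] := boolP (x <= y)%O.
    case/negP: xy; rewrite le eq_sym eqb_id setSI //.
    by move/embedsP: embf => <-.
  by move: xy; rewrite (negbTE nle) eq_sym eqbF_neg negbK.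
have [p {}privP] := fin_all_exists priv.
have notsub i : i \in I -> ~~ (f (p i).1 :&: I \subset f (p i).2 :&: I).
  by move=> /privP/andP[+ _]; move/embedsP: sepI => ->.
have trace i j : i \in I -> j \in I -> i != j ->
    i \in f (p j).1 -> i \in f (p j).2.
  move=> iI jI ij ij1; have /andP[_ /subsetP/(_ i)] := privP j jI.
  by rewrite !inE ij iI ij1 => /(_ isT)/andP[].
(* Vertices are the elements of [P], the edge of [i] is its pair [p i], and its cut is the set of
   [x] with [i \in f x]. *)
have [] := @private_cuts_bound V P I setT (fun i => (p i).1) (fun i => (p i).2)
  (fun i => [set x | i \in f x]).
- by move=> i _; rewrite !inE.
- move=> i j iI jI; rewrite !inE; have [<-|ij] := eqVneq i j; last first.
    by apply/andP => -[/(trace i j iI jI ij)->].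
  have /subsetPn[e /setIP[e1 eI]] := notsub i iI.
  rewrite inE eI andbT => e2; have [ei|ei] := eqVneq e i; last first.
    by rewrite (trace e i) in e2.
  by rewrite ei in e1 e2; rewrite e1 e2.
- by rewrite cardsT => h; exact: leq_trans h (leq_addr _ _).
(* Here [4w <= 8n - 8 <= n^2 + 8], since [(n - 4)^2] is nonnegative; the case [n = 4] dictates the
   constant 8. *)
- rewrite cardsT -mulnn; move: #|P| #|I| => n w h.
  have [n4|n4] := leqP n 4; first by case: n h n4 => [|[|[|[|[|]]]]] //; lia.
  by nia.
Qed.

(** Principal down-sets provide an embedding, so a least height exists. *)
Lemma down_set_embeds :
  embeds (fun x => [set enum_rank y | y : P & (y <= x)%O]).
Proof.
apply/embedsP => x y; apply/idP/idP => [xy|/subsetP/(_ (enum_rank x))].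
  apply/subsetP => _ /imsetP[z zx ->]; apply: imset_f.
  by move: zx; rewrite !inE => zx; exact: le_trans zx xy.
rewrite imset_f ?inE // => /(_ isT)/imsetP[z + /enum_rank_inj->].
by rewrite inE.
Qed.

Lemma contains_induced_copyP n (F : {set {set 'I_n}}) :
  reflect (exists2 f : P -> {set 'I_n}, embeds f & forall x, f x \in F)
          (contains_induced_copy P F).
Proof.
apply: (iffP existsP) => [[f /and3P[_ /forallP fF emb]]|[f emb fF]].
  by exists f.
exists (finfun f); apply/and3P; split.
- by apply/injectiveP => x y; rewrite !ffunE; exact: embeds_inj.
- by apply/forallP => x; rewrite ffunE.
- apply/forallP => x; apply/forallP => y; rewrite !ffunE.
  by move/embedsP: emb => ->.
Qed.

(* Sets of size less than [h] are used as they are; a set of size [h] is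
   replaced by a member of [F] with that trace on [W]. Since [h] bounds all
   sizes, no set lies strictly above a replaced one. *)
Lemma shatters_contains_copy w n (f : P -> {set 'I_w}) h
    (F : {set {set 'I_n}}) (W : {set 'I_n}) :
  embeds f -> (forall x, #|f x| <= h) ->
  (forall S : {set 'I_n}, #|S| < h -> S \in F) ->
  #|W| = w -> shatters F W -> contains_induced_copy P F.
Proof.
move=> /embedsP embf fh smallF Ww /shattersP sh.
pose g (k : 'I_w) : 'I_n := enum_val (cast_ord (esym Ww) k).
have g_inj : injective g by move=> k l /enum_val_inj/cast_ord_inj.
have gW (A : {set 'I_w}) : g @: A \subset W.
  by apply/subsetP => _ /imsetP[k _ ->]; exact: enum_valP.
have ex x : exists S : {set 'I_n},
    [/\ S \in F, S :&: W = g @: f x & #|f x| < h -> S = g @: f x].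
  have [lt|ge] := ltnP #|f x| h.
    exists (g @: f x); split=> //; last exact/setIidPl/gW.
    by rewrite smallF // card_imset.
  by have [S SF SW] := sh _ (gW (f x)); exists S.
have [e eP] := fin_all_exists ex.
have eF x : e x \in F by case: (eP x).
have eW x : e x :&: W = g @: f x by case: (eP x).
have eS x : #|f x| < h -> e x = g @: f x by case: (eP x).
apply/contains_induced_copyP; exists e => //; apply/embedsP => x y.
apply/idP/idP => [xy|exy].
  have [->//|nxy] := eqVneq x y.
  have lt : f x \proper f y.
    rewrite properE -!embf xy; apply: contraNN nxy => yx.
    by apply/eqP/le_anti; rewrite xy yx.
  rewrite eS; last exact: leq_trans (proper_card lt) (fh y).
  by apply: subset_trans (imsetS g (proper_sub lt)) _; rewrite -eW subsetIl.
rewrite embf; apply/subsetP => k kx.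
have : g k \in e y :&: W.
  by apply: (subsetP (setSI W exy)); rewrite eW imset_f.
by rewrite eW => /imsetP[l ly /g_inj->].
Qed.

Lemma sat_num_le w n (f : P -> {set 'I_w}) h :
  0 < #|P| -> embeds f -> (forall x, #|f x| <= h) ->
  (forall g : P -> {set 'I_n}, embeds g -> exists x, h <= #|g x|) ->
  sat_num P n <= n.+1 ^ w.-1.
Proof.
move=> P0 embf fh minh.
pose F0 := [set S : {set 'I_n} | #|S| < h].
have F0free : ~~ contains_induced_copy P F0.
  apply/contains_induced_copyP => -[g embg gF].
  by have [x] := minh g embg; rewrite leqNgt; have := gF x; rewrite inE => ->.
have [F /maxsetP[Ffree maxF] F0F] :=
  @maxset_exists _ [pred F : {set {set 'I_n}} | ~~ contains_induced_copy P F]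
    _ F0free.
have satF : saturated P F.
  apply/andP; split=> //; apply/forallP => S; apply/implyP.
  apply: contraNT => hS.
  by rewrite -(maxF (S |: F) hS (subsetU1 _ _)) setU11.
have [_ /(_ F satF) le] := sat_numP n P0; apply: leq_trans le _.
have := @card_no_shattered _ F w; rewrite card_ord; apply => W Ww.
apply/negP => sh.
case/negP: Ffree; apply: (shatters_contains_copy embf fh _ Ww sh) => S Sh.
by apply: (subsetP F0F); rewrite inE.
Qed.

Lemma sat_num_polynomial : 0 < #|P| ->
  exists2 w, 4 * w <= #|P| ^ 2 + 8 & forall n, sat_num P n <= n.+1 ^ w.-1.
Proof.
move=> P0.
(* The height is minimized over cubes of all dimensions [N], so that [h] and [w] do not depend on
   [n]. *)
pose height h := `[< exists N (f : P -> {set 'I_N}),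
  embeds f /\ forall x, #|f x| <= h >].
have exh : exists h, height h.
  exists #|P|; apply/asboolP; eexists #|P|, _.
  by split=> [|x]; [exact: down_set_embeds|rewrite -[leqRHS]card_ord max_card].
case: (ex_minnP exh) => h /asboolP[N [f0 [emb0 f0h]]] minh.
have [w [f [embf fsmall w_le]]] := embeds_small_ground P0 emb0.
exists w => // n; apply: (sat_num_le (f := f) (h := h)) => //.
  by move=> x; exact: leq_trans (fsmall x) (f0h x).
move=> g embg; case: h minh {f0h} => [|h] minh.
  by have /card_gt0P[x _] := P0; exists x.
apply/existsP; apply: contraT => /existsPn gh.
suff : h < h by rewrite ltnn.
apply: minh; apply/asboolP; exists n, g; split=> // x.
by rewrite leqNgt gh.
Qed.

End Embeddings.
End Combinatorics.

(** * From the polynomial bound to the asymptotic statement *)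

Local Open Scope classical_set_scope.
Local Open Scope ring_scope.

Theorem theorem1p1 (R : realType) (d : Order.disp_t) (P : finPOrderType d) :
  exists c : R,
    c <= #|P|%:R ^+ 2 / 4 + 1 /\
    (fun n : nat => (sat_num P n)%:R : R^o) =O_\oo
      (fun n : nat => n%:R `^ c : R^o).
Proof.
have [w w_le sat_le] : exists2 w, (4 * w <= #|P| ^ 2 + 8)%N &
    forall n, (sat_num P n <= n.+1 ^ w.-1)%N.
  (* An empty [P] has a copy in every family, so no family is saturated, [sat_num] is 0 and [w = 0]
     will do. *)
  have [P0|] := posnP #|P|; last exact: sat_num_polynomial.
  exists 0%N => // n; rewrite /sat_num /arg_min /extremum.
  case: pickP => [F /andP[/andP[/negP[]]]|_] /=; last by rewrite finset.cards0.
  apply/contains_induced_copyP.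
  have P_empty (x : P) : False by have := fintype0 x P0.
  exists (fun x => False_rect _ (P_empty x)) => [|x]; last by case: (P_empty x).
  by apply/embedsP => x; case: (P_empty x).
exists (w.-1)%:R; split.
  have : (4 * w.-1 <= #|P| ^ 2 + 4)%N by lia.
  by rewrite -(ler_nat R) natrD natrM natrX; lra.
(* The constant comes from [n + 1 <= 2n] for positive [n]. *)
apply/eqO_exP; exists (2 ^+ w.-1); first by rewrite exprn_gt0.
near=> n; rewrite powR_mulrn // !ger0_norm //.
rewrite -exprMn -natrM -natrX ler_nat.
apply: leq_trans (sat_le n) _; case: (w.-1) => // k; rewrite leq_exp2r //.
have n0 : (0 < n)%N by near: n; exact: nbhs_infty_gt.
by lia.
Unshelve. all: by end_near.
Qed.
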